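(* Let $G$ be a connected $3K_1$-free graph and let $u,v$ be distinct vertices of $G$. Then $G$ has a Hamiltonian path with end-vertices $u$ and $v$ if and only if (a) neither $u$ nor $v$ is an articulation point of $G$, and (b) for every articulation point $x$ of $G$, the vertices $u$ and $v$ belong to different connected components of $G-\{x\}$, and (c) $\{u,v\}$ is not a minimum vertex cut of $G$. Moreover, this happens if and only if $G$ satisfies (a), (b) and (c') $\{u,v\}$ is not a vertex cut of size two in $G$.
   Context: Graphs are finite, simple and undirected. A graph is $3K_1$-free if it contains no three pairwise non-adjacent vertices (i.e., its independence number is at most 2). A Hamiltonian path is a path containing all vertices of the graph. A vertex cut of $G$ is a set $A\subset V(G)$ such that $G-A$ is disconnected; an articulation point is a vertex $x$ such that $\{x\}$ is a vertex cut. The vertex connectivity of $G$ is the minimum size of a vertex cut (or $|V(G)|-1$ if $G$ is complete), and a minimum vertex cut is a vertex cut whose size equals the vertex connectivity. *)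

(* Defs.v *)
From mathcomp Require Import all_boot.

Set Implicit Arguments.
Unset Strict Implicit.
Unset Printing Implicit Defensive.

(* The vertex set is the whole finType [T]; adjacency is [e]. *)
Definition simple_graph (T : finType) (e : rel T) : Prop :=
  symmetric e /\ irreflexive e.

Definition connected_graph (T : finType) (e : rel T) : Prop :=
  0 < #|T| /\ forall x y : T, connect e x y.

Definition free_3K1 (T : finType) (e : rel T) : Prop :=
  ~ exists x y z : T,
      [/\ x != y, x != z & y != z] /\ [/\ ~~ e x y, ~~ e x z & ~~ e y z].

Definition hamiltonian_path (T : finType) (e : rel T) (u v : T) : Prop :=
  exists p : seq T,
    [/\ path e u p, last u p = v, uniq (u :: p) & forall x : T, x \in u :: p].

(* Adjacency of G - A. The carrier remains [T], so the vertices of A become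
   isolated points: reachability in G - A is meaningful only outside A. *)
Definition del_rel (T : finType) (e : rel T) (A : {set T}) : rel T :=
  [rel x y | [&& x \notin A, y \notin A & e x y]].

Definition diff_components (T : finType) (e : rel T) (A : {set T}) (x y : T) :
    bool :=
  [&& x \notin A, y \notin A & ~~ connect (del_rel e A) x y].

(* In particular, the empty graph does not count as disconnected. *)
Definition vertex_cut (T : finType) (e : rel T) (A : {set T}) : bool :=
  [exists x : T, exists y : T, diff_components e A x y].

Definition articulation_point (T : finType) (e : rel T) (x : T) : bool :=
  vertex_cut e [set x].

Definition complete_graph (T : finType) (e : rel T) : bool :=
  [forall x : T, forall y : T, (x != y) ==> e x y].

(* The default #|T| of the minimum is never attained: a non-complete graph has
   a vertex cut, and vertex cuts are proper subsets of the vertex set. *)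
Definition vertex_connectivity (T : finType) (e : rel T) : nat :=
  if complete_graph e then #|T|.-1
  else \big[minn/#|T|]_(A : {set T} | vertex_cut e A) #|A|.

Definition minimum_vertex_cut (T : finType) (e : rel T) (A : {set T}) : bool :=
  vertex_cut e A && (#|A| == vertex_connectivity e).

(* Main.v *)
(* Sufficiency is a Chvatal-Erdos argument. Let s be a longest path from u to
   v, let w be a vertex off s, let H be the component of w in G - s and N the
   set of neighbours of H on s. If a, b in N both differ from v, the successors
   of a and b on s together with w would be independent, since otherwise s
   could be rerouted through H; hence at most one element of N differs from v
   and, by reversal, at most one differs from u. If N = {a}, then a is an
   articulation point and w, u, v are independent. Otherwise N = {u, v}, and
   {u, v} separates H from the inner vertices of s; an articulation point would
   have to lie both on s and in H to separate u from v, so there is none.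
   This last point also shows that (c) and (c') are interchangeable: a
   2-vertex cut that is not minimum forces an articulation point. *)
Require Import Defs.
From mathcomp Require Import all_boot zify.

Set Implicit Arguments.
Unset Strict Implicit.
Unset Printing Implicit Defensive.

Lemma bigminn_leq (I : eqType) (d : nat) (r : seq I) (P : pred I) F i :
  i \in r -> P i -> \big[minn/d]_(j <- r | P j) F j <= F i.
Proof.
elim: r => // j r IHr ir Pi; rewrite big_cons; move: ir; rewrite inE.
case/predU1P=> [<-|/IHr le_i]; first by rewrite Pi geq_minl.
by case: ifP => _; rewrite ?geq_min le_i ?orbT.
Qed.

Section Graph.

Variables (T : finType) (e : rel T).
Hypothesis e_sym : symmetric e.

(** * Reachability after deleting vertices *)

Lemma del_rel_sym (A : {set T}) : symmetric (del_rel e A).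
Proof. by move=> x y; rewrite /del_rel /= e_sym andbCA. Qed.

Lemma connect_del_sym (A : {set T}) : connect_sym (del_rel e A).
Proof. exact/sym_connect_sym/del_rel_sym. Qed.

Lemma path_del_notin (A : {set T}) x p z :
  x \notin A -> path (del_rel e A) x p -> z \in x :: p -> z \notin A.
Proof.
elim: p x => [|y p IHp] x xA /=; first by rewrite inE => _ /eqP->.
case/andP=> /and3P[_ yA _] yp; rewrite inE => /predU1P[-> //|].
exact: IHp yp.
Qed.

Lemma connect_del_notin (A : {set T}) x y :
  x \notin A -> connect (del_rel e A) x y -> y \notin A.
Proof.
by move=> xA /connectP[p xp ->]; apply: path_del_notin xA xp (mem_last _ _).
Qed.

Lemma sorted_connect_del (A : {set T}) s :
  sorted e s -> {in s, forall z, z \notin A} ->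
  {in s &, forall x y, connect (del_rel e A) x y}.
Proof.
case: s => // z p zp pA.
have from_z y : y \in z :: p -> connect (del_rel e A) z y.
  apply: path_connect; elim: p z zp pA => //= y' p IHp z /andP[zy' y'p] pA.
  rewrite /del_rel /= !pA ?inE ?eqxx ?orbT // zy' /= IHp // => t tp.
  by apply: pA; rewrite inE tp orbT.
by move=> x y xp yp; apply: connect_trans (from_z y yp);
   rewrite connect_del_sym from_z.
Qed.

Lemma vertex_cutPn (A : {set T}) :
  reflect (forall x y, x \notin A -> y \notin A -> connect (del_rel e A) x y)
          (~~ vertex_cut e A).
Proof.
apply: (iffP idP) => [cutN x y xA yA | conA].
  apply: contraNT cutN => xy; apply/existsP; exists x; apply/existsP; exists y.
  by rewrite /diff_components xA yA.
apply/existsP=> -[x /existsP[y /and3P[xA yA]]].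
by rewrite conA.
Qed.

(** * Necessity of the conditions *)

Lemma hamiltonian_path_sym u v :
  hamiltonian_path e u v -> hamiltonian_path e v u.
Proof.
case=> p [up pv p_uniq pT]; exists (rev (belast u p)).
have rev_p : v :: rev (belast u p) = rev (u :: p).
  by rewrite (lastI u p) pv rev_rcons.
split; last by move=> x; rewrite rev_p mem_rev.
- by rewrite -pv rev_path (eq_path (e' := e)) // => x y; rewrite e_sym.
- by case: p {up p_uniq pT rev_p} pv => //= y p _; rewrite rev_cons last_rcons.
- by rewrite rev_p rev_uniq.
Qed.

(** Deleting the first vertex leaves a path through all the others. *)
Lemma hamiltonian_not_articulation u v :
  hamiltonian_path e u v -> ~~ articulation_point e u.
Proof.
case=> p [up _ /andP[uNp _] pT]; apply/vertex_cutPn=> x y.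
have mem_p z : z \notin [set u] -> z \in p.
  by move: (pT z); rewrite !inE => /predU1P[->|//]; rewrite eqxx.
move=> /mem_p xp /mem_p yp; apply: sorted_connect_del xp yp.
  exact: path_sorted up.
by move=> z zp; rewrite inE; apply: contraNneq uNp => <-.
Qed.

(** Since [x] is an inner vertex, deleting it leaves two pieces of the path, one holding [u] and the
    other [v]. Were [u] and [v] still connected, so would be everything outside [x]. *)
Lemma hamiltonian_separated u v x :
  hamiltonian_path e u v -> articulation_point e x ->
  diff_components e [set x] u v.
Proof.
move=> uv x_art.
have xNu : x != u.
  apply: contraTneq x_art => ->.
  exact: hamiltonian_not_articulation uv.
have xNv : x != v.
  apply: contraTneq x_art => ->.
  exact/hamiltonian_not_articulation/hamiltonian_path_sym/uv.
rewrite /diff_components !inE !(eq_sym _ x) xNu xNv /=.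
apply: contraL x_art => con_uv; apply/vertex_cutPn.
case: uv => p [up pv p_uniq pT].
have: x \in p by move: (pT x); rewrite inE (negPf xNu).
move=> /path.splitPr def_p; case: def_p up pv p_uniq pT => p1 p2.
rewrite cat_path last_cat -cat_cons cat_uniq /= => /and3P[up1 _ xp2] p2v.
rewrite negb_or /= => /and4P[_ /andP[xNp1 _] xNp2 _] pT.
have [p1x p2x]: {in u :: p1, forall z, z \notin [set x]} /\
                {in p2, forall z, z \notin [set x]}.
  split=> z zp; rewrite inE; [apply: contraNneq xNp1 | apply: contraNneq xNp2];
  by move <-.
have vp2 : v \in p2.
  by move: (mem_last x p2); rewrite p2v inE eq_sym (negPf xNv).
have from_u z : z \notin [set x] -> connect (del_rel e [set x]) u z.
  rewrite inE => zNx; move: (pT z); rewrite -cat_cons mem_cat [z \in x :: _]inE.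
  rewrite (negPf zNx) => /orP[zp1 | zp2].
    exact: (sorted_connect_del (s := u :: p1)) (mem_head _ _) zp1.
  apply: connect_trans con_uv _.
  exact: sorted_connect_del (path_sorted xp2) p2x _ _ vp2 zp2.
move=> y z /from_u uy /from_u uz.
by apply: connect_trans uz; rewrite connect_del_sym.
Qed.

Lemma hamiltonian_not_cut2 u v :
  hamiltonian_path e u v -> ~~ vertex_cut e [set u; v].
Proof.
case=> p; case/lastP: p => [|p v'] [].
  move=> _ /= <- _ uT; apply/vertex_cutPn=> x y.
  by move: (uT x); rewrite !inE => /eqP->; rewrite eqxx.
rewrite last_rcons cons_uniq => up -> /andP[]; move: up.
rewrite rcons_path mem_rcons inE negb_or => /andP[up _] /andP[_ uNp].
rewrite rcons_uniq => /andP[vNp _] pT; apply/vertex_cutPn=> x y.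
have mem_p z : z \notin [set u; v] -> z \in p.
  by move: (pT z); rewrite !inE mem_rcons inE; case: (z == u); case: (z == v).
move=> /mem_p xp /mem_p yp; apply: sorted_connect_del xp yp.
  exact: path_sorted up.
move=> z zp; rewrite !inE negb_or.
by apply/andP; split; [apply: contraNneq uNp | apply: contraNneq vNp] => <-.
Qed.

(** A graph with a vertex cut is not complete, so its connectivity is a genuine minimum. Without
    articulation points no cut is a singleton, and by connectedness none is empty, so a cut of size
    two attains the minimum. *)
Lemma cut_connectivity2 (A : {set T}) :
  connected_graph e -> vertex_cut e A -> #|A| = 2 ->
  ~~ minimum_vertex_cut e A -> exists x, articulation_point e x.
Proof.
move=> [_ conT] cutA cardA; rewrite /minimum_vertex_cut cutA cardA /=.
rewrite /vertex_connectivity ifN; last first.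
  apply: contraL cutA => /forallP complT; apply/vertex_cutPn=> x y xA yA.
  have [->|xNy] := eqVneq x y; first exact: connect0.
  apply: connect1; rewrite /del_rel /= xA yA /=.
  by move/forallP: (complT x) => /(_ y); rewrite xNy.
move=> min_neq2; apply/existsP; apply: contraR min_neq2 => noart.
rewrite eqn_leq; apply/andP; split; last first.
  by rewrite -cardA bigminn_leq ?mem_index_enum.
(* The default [#|T|] must be at least 2 as well: it bounds [#|A|]. *)
apply: (big_ind (leq 2)) => [|m n|B cutB]; first by rewrite -cardA max_card.
  by rewrite leq_min => -> ->.
rewrite ltnNge leq_eqVlt ltnS leqn0 cards_eq0; apply/norP; split.
  apply: contra noart => /cards1P[x defB]; apply/existsP; exists x.
  by rewrite /articulation_point -defB.
apply: contraL cutB => /eqP->; apply/vertex_cutPn=> x y _ _.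
rewrite (eq_connect (e' := e)) // => z t.
by rewrite /del_rel /= !inE.
Qed.

(** * Longest paths with prescribed ends, and their rerouting *)

(** Listing [u] in the sequence makes reversal a plain exchange of [u] and [v]. The crossed defaults
    of [head] and [last] exclude the empty sequence when [u != v]. *)
Definition upath (u v : T) (s : seq T) : bool :=
  [&& sorted e s, uniq s, head v s == u & last u s == v].

Lemma upath_rev u v s : upath u v s -> upath v u (rev s).
Proof.
case/and4P=> s_sorted s_uniq su sv; apply/and4P; split.
- by rewrite rev_sorted (eq_sorted (e' := e)) // => a b; rewrite e_sym.
- by rewrite rev_uniq.
- by rewrite -(eqP sv); case/lastP: (s) => // r z; rewrite rev_rcons last_rcons.
- by rewrite -(eqP su); case: (s) => // z r; rewrite rev_cons last_rcons.
Qed.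

Definition longest_upath (u v : T) (s : seq T) : Prop :=
  upath u v s /\ forall t, upath u v t -> size t <= size s.

Lemma longest_upath_rev u v s :
  longest_upath u v s -> longest_upath v u (rev s).
Proof.
case=> sP s_max; split; first exact: upath_rev.
by move=> t /upath_rev /s_max; rewrite !size_rev.
Qed.

Lemma longest_upath_exists u v t :
  upath u v t -> exists s, longest_upath u v s.
Proof.
move=> tP; pose P n := [exists s : n.-tuple T, upath u v s].
have exP : exists n, P n.
  by exists (size t); apply/existsP; exists (in_tuple t).
have leP n : P n -> n <= #|T|.
  case/existsP=> s /and4P[_ s_uniq _ _].
  by rewrite -(size_tuple s) -(card_uniqP s_uniq) max_card.
case: (ex_maxnP exP leP) => n /existsP[s sP] n_max; exists s.
split=> // s' s'P; rewrite size_tuple; apply: n_max.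
by apply/existsP; exists (in_tuple s').
Qed.

(* The component of w in G - s is adjacent to a. *)
Definition touches (s : seq T) (w a : T) : bool :=
  [exists h, connect (del_rel e [set z in s]) w h && e h a].

(** Enter the component of [w] next to [a], cross it by a walk shortened to a path, and leave next
    to [b]. *)
Lemma detour s w a b :
  w \notin s -> touches s w a -> touches s w b ->
  exists q, [/\ 0 < size q, path e a (rcons q b), uniq q,
              {in q, forall z, z \notin s}
            & {in q, forall z, connect (del_rel e [set z in s]) w z}].
Proof.
move=> ws /existsP[h /andP[wh ha]] /existsP[h' /andP[wh' h'b]].
have hs : h \notin [set z in s] by apply: connect_del_notin wh; rewrite inE.
have hh' : connect (del_rel e [set z in s]) h h'.
  by apply: connect_trans wh'; rewrite connect_del_sym.
case/connectP: hh' h'b => p0 hp0 ->.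
case/shortenP: hp0 => p hp p_uniq _ h'b; exists (h :: p); split=> //.
- rewrite /= e_sym ha rcons_path h'b andbT /=.
  by apply: sub_path hp => x y /and3P[].
- by move=> z /(path_del_notin hs hp); rewrite inE.
- by move=> z /(path_connect hp); apply: connect_trans.
Qed.

(** The contradiction shared by all reroutings: [t] keeps the vertices of [s] and absorbs [q], so it
    is longer. The [perm_eq] form reduces the bookkeeping to counting. *)
Lemma longest_upath_no_absorption u v s q t :
  longest_upath u v s -> 0 < size q -> uniq q -> {in q, forall z, z \notin s} ->
  perm_eq t (q ++ s) -> sorted e t -> head v t = u -> last u t = v -> False.
Proof.
case=> /and4P[_ s_uniq _ _] s_max q_gt0 q_uniq qs tqs t_sorted tu tv.
suff /s_max : upath u v t.
  by rewrite (perm_size tqs) size_cat -[leqRHS]add0n leq_add2r leqNgt q_gt0.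
rewrite /upath t_sorted tu tv !eqxx (perm_uniq tqs) cat_uniq q_uniq s_uniq.
rewrite !andbT /=; apply/hasPn=> z zs; apply: contraL zs; exact: qs.
Qed.

(** Otherwise a detour fits between [a] and [b]. *)
Lemma longest_not_consecutive u v w a b s1 s2 :
  let s := s1 ++ a :: b :: s2 in
  longest_upath u v s -> w \notin s -> ~ (touches s w a /\ touches s w b).
Proof.
move=> s sP ws [wa wb].
have [q [q_gt0 aqb q_uniq qs _]] := detour ws wa wb.
have /and4P[s_sorted _ /eqP su /eqP sv] := proj1 sP.
pose t := s1 ++ a :: q ++ b :: s2.
apply: (longest_upath_no_absorption (t := t) sP q_gt0 q_uniq qs).
- by apply/permP=> P; rewrite /t /s !count_cat /= count_cat /=; lia.
- move: s_sorted aqb; rewrite /t /s rcons_path.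
  case: s1 {s sP ws wa wb qs su sv t} => [|c s1] /=;
    rewrite ?cat_path /= ?cat_path /=.
    by move=> /andP[_ ->] /andP[-> ->].
  by move=> /and4P[-> -> _ ->] /andP[-> ->].
- by rewrite -su /t /s; case: (s1).
- by rewrite -sv /t /s !last_cat /= last_cat.
Qed.

Lemma longest_not_crossed u v w a a' b b' s1 s2 s3 :
  let s := s1 ++ a :: a' :: s2 ++ b :: b' :: s3 in
  longest_upath u v s -> w \notin s -> touches s w a -> touches s w b ->
  ~~ e a' b'.
Proof.
move=> s sP ws wa wb; apply/negP=> a'b'.
have [q [q_gt0 aqb q_uniq qs _]] := detour ws wa wb.
have /and4P[s_sorted _ /eqP su /eqP sv] := proj1 sP.
(* a jumps through q to b, then s is run backwards to a', then a' -- b'. *)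
pose t := s1 ++ a :: q ++ b :: rcons (rev s2) a' ++ b' :: s3.
apply: (longest_upath_no_absorption (t := t) sP q_gt0 q_uniq qs).
- apply/permP=> P; rewrite /t /s -cats1.
  by do 3!rewrite !(count_cat, count_rev) /=; lia.
- have rev_mid : path e a' (rcons s2 b) = path e b (rcons (rev s2) a').
    have := rev_path e a' (rcons s2 b).
    rewrite last_rcons belast_rcons rev_cons => ->.
    by apply: eq_path => x y; rewrite e_sym.
  have cat_cons_sorted r x r' :
      sorted e (r ++ x :: r') = sorted e (rcons r x) && path e x r'.
    by case: r => //= y r; rewrite -cat_rcons cat_path last_rcons.
  move: s_sorted; rewrite /s /t !cat_cons_sorted => /andP[-> /=].
  case/andP=> _; rewrite -cat_rcons cat_path last_rcons rev_mid.
  case/andP=> bs2 /andP[_ b's3].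
  by rewrite -cat_rcons cat_path aqb last_rcons cat_path bs2 last_rcons /= a'b'.
- by rewrite -su /s /t; case: (s1).
- by rewrite -sv /s /t !last_cat /= !last_cat /= !last_cat.
Qed.

(** * Where the component of [w] attaches to a longest path *)

Lemma free_3K1_adj x y z :
  free_3K1 e -> x != y -> x != z -> y != z -> [|| e x y, e x z | e y z].
Proof.
move=> free xy xz yz; apply/negP=> /negP; rewrite !negb_or.
case/and3P=> exy exz eyz; by apply: free; exists x, y, z.
Qed.

Lemma neighbour_touches (s : seq T) w a : e w a -> touches s w a.
Proof. by move=> wa; apply/existsP; exists w; rewrite connect0. Qed.

(** If [b] is not last, [a] and [b] have successors [a'] and [b']. These are not adjacent to [w] by
    [longest_not_consecutive], nor to each other by [longest_not_crossed], which gives an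
    independent triple. *)
Lemma touches_before_end u v w a b s1 s2 :
  free_3K1 e -> b \in s2 -> longest_upath u v (s1 ++ a :: s2) ->
  w \notin s1 ++ a :: s2 ->
  touches (s1 ++ a :: s2) w a -> touches (s1 ++ a :: s2) w b -> b = v.
Proof.
move=> free /path.splitPr[r1 [|b' r2]].
  by case=> /and4P[_ _ _ /eqP]; rewrite !(last_cat, last_cons).
(* If [r1] is empty, the successor of [a] is [b] itself, and two consecutive vertices are
   touched. *)
case: r1 => [|a' r1] sP ws wa wb.
  by case: (longest_not_consecutive sP ws).
set s := s1 ++ _ in sP ws wa wb.
have wNs z : z \in s -> z != w by apply: contraTneq => ->.
have a's : a' \in s by rewrite /s !(mem_cat, inE) eqxx !orbT.
have b's : b' \in s by rewrite /s !(mem_cat, inE) eqxx !orbT.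
have a'b' : a' != b'.
  have /and4P[_ s_uniq _ _] := proj1 sP.
  apply: contraTneq s_uniq => a'b'; rewrite /s -a'b' cat_uniq /=.
  rewrite !(mem_cat, inE) eqxx.
  by rewrite !orbT !andbF.
have a'w : ~~ e a' w.
  rewrite e_sym; apply/negP=> /(@neighbour_touches s) wa'.
  by apply: (@longest_not_consecutive u v w a a' s1 (r1 ++ [:: b, b' & r2])).
have b'w : ~~ e b' w.
  rewrite e_sym; apply/negP=> /(@neighbour_touches s) wb'.
  have def_s : s = (s1 ++ a :: a' :: r1) ++ [:: b, b' & r2].
    by rewrite -catA.
  rewrite def_s in sP ws wb wb'.
  exact: (longest_not_consecutive sP ws).
have := free_3K1_adj free a'b' (wNs _ a's) (wNs _ b's).
rewrite (negPf a'w) (negPf b'w) !orbF => a'b'_adj.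
by have := longest_not_crossed sP ws wa wb; rewrite a'b'_adj.
Qed.

(** Whichever of two distinct touched vertices comes first on [s], the other one must be [v]. *)
Lemma touches_inj_but_end u v w a b s :
  free_3K1 e -> longest_upath u v s -> w \notin s ->
  a \in s -> touches s w a -> a != v -> b \in s -> touches s w b -> b != v ->
  a = b.
Proof.
move=> free sP ws /path.splitPr def_s.
case: def_s sP ws => s1 s2 sP ws wa aNv.
rewrite mem_cat inE => bs wb bNv; case/or3P: bs => [|/eqP->|] // bs.
  case/path.splitPr: bs sP ws wa wb => r1 r2; rewrite -catA /= => sP ws wa wb.
  case/eqP: aNv; apply: (touches_before_end free _ sP ws wb wa).
  by rewrite mem_cat mem_head orbT.
by case/eqP: bNv; apply: (touches_before_end free bs sP ws wa wb).
Qed.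

Lemma touches_rev s w a : touches (rev s) w a = touches s w a.
Proof.
rewrite /touches; have -> : [set z in rev s] = [set z in s] => //.
by apply/setP=> z; rewrite !inE mem_rev.
Qed.

Lemma touches_inj_but_start u v w a b s :
  free_3K1 e -> longest_upath u v s -> w \notin s ->
  a \in s -> touches s w a -> a != u -> b \in s -> touches s w b -> b != u ->
  a = b.
Proof.
move=> free /longest_upath_rev sP; rewrite -(mem_rev s w) -(mem_rev s a).
rewrite -(mem_rev s b) -(touches_rev s w a) -(touches_rev s w b).
exact: touches_inj_but_end free sP.
Qed.

(** A walk from [w] can enter [s] only at a touched vertex, and all of these lie in [A]. *)
Lemma connect_del_component (A : {set T}) s w y :
  w \notin s -> {in s, forall z, touches s w z -> z \in A} ->
  connect (del_rel e A) w y -> connect (del_rel e [set z in s]) w y.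
Proof.
move=> ws sA /connectP[p wp ->]; elim/last_ind: p wp => [|p z IHp].
  by rewrite connect0.
rewrite rcons_path last_rcons => /andP[/IHp{}IHp /and3P[_ zA yz]].
apply: connect_trans (IHp) (connect1 _).
have := connect_del_notin _ IHp; rewrite !inE /del_rel /= !inE yz andbT.
move=> -> //=; apply: contra zA => zs; apply: sA => //.
by apply/existsP; exists (last w p); rewrite IHp.
Qed.

(** If nothing were touched, the previous lemma with [A] empty would keep every walk from [w] off
    [s]. *)
Lemma connected_touches s w x :
  connected_graph e -> w \notin s -> x \in s ->
  exists2 a, a \in s & touches s w a.
Proof.
move=> [_ conT] ws xs; case: (pickP (fun a => (a \in s) && touches s w a)).
  by move=> a /andP[a_s wa]; exists a.
move=> noa; have: connect (del_rel e [set z in s]) w x.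
  apply: (connect_del_component (A := set0)) => // [a a_s wa|].
    by have := noa a; rewrite a_s wa.
  rewrite (eq_connect (e' := e)) // => z t.
  by rewrite /del_rel /= !inE.
by move/(connect_del_notin _); rewrite !inE xs => /(_ ws).
Qed.

(** * Sufficiency of the conditions *)

(** The hypothesis on [[set u; v]] is a common weakening of (c) and (c'): it follows from (c) by
    [cut_connectivity2], and under (c') it holds vacuously. *)
Lemma hamiltonian_path_of_articulation u v :
  connected_graph e -> free_3K1 e -> u != v ->
  ~~ articulation_point e u -> ~~ articulation_point e v ->
  (forall x, articulation_point e x -> diff_components e [set x] u v) ->
  (vertex_cut e [set u; v] -> exists x, articulation_point e x) ->
  hamiltonian_path e u v.
Proof.
move=> conT free uNv uNart vNart sep cut_art.
have [s sP] : exists s, longest_upath u v s.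
  case/connectP: (conT.2 u v) => p0 up0 def_v.
  case/shortenP: up0 def_v => p up p_uniq _ def_v.
  apply: (@longest_upath_exists _ _ (u :: p)).
  by rewrite /upath [sorted _ _]up p_uniq /= -def_v !eqxx.
have /and4P[s_sorted s_uniq /eqP su /eqP sv] := proj1 sP.
have us : u \in s.
  by case: (s) su sv => [_ /eqP|x r /= <- _]; rewrite ?(negPf uNv) ?mem_head.
have vs : v \in s.
  by case: (s) su sv => [/esym/eqP|x r _ <- /=]; rewrite ?(negPf uNv) ?mem_last.
have [/forallP sT | /forallPn[w ws]] := boolP [forall x, x \in s].
  case: s su sv s_sorted s_uniq sT {sP us vs} => [|x p /= -> pv up p_uniq sT].
    by move=> /= vu; rewrite vu eqxx in uNv.
  by exists p; split.
exfalso.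
have wNs : w \notin [set z in s] by rewrite inE.
have reach (A : {set T}) y :
    {in s, forall z, touches s w z -> z \in A} ->
    connect (del_rel e A) w y -> y \notin s.
  move=> sA /(connect_del_component ws sA)/(connect_del_notin wNs).
  by rewrite inE.
have neq_w z : z \in s -> w != z by apply: contraTneq => <-.
have [a a_s wa] := connected_touches conT ws us.
have [b /and3P[b_s wb bNa] | only_a] :=
    pickP (fun b => [&& b \in s, touches s w b & b != a]).
(* At most one touched vertex differs from [u], so one of [a], [b] is [u]; likewise for [v]. *)
- have wu : touches s w u.
    have [<- //|aNu] := eqVneq a u; have [<- //|bNu] := eqVneq b u.
    have ba := touches_inj_but_start free sP ws b_s wb bNu a_s wa aNu.
    by rewrite ba eqxx in bNa.
  have wv : touches s w v.
    have [<- //|aNv] := eqVneq a v; have [<- //|bNv] := eqVneq b v.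
    have ba := touches_inj_but_end free sP ws b_s wb bNv a_s wa aNv.
    by rewrite ba eqxx in bNa.
  have only_uv : {in s, forall z, touches s w z -> z \in [set u; v]}.
    move=> z zs wz; rewrite !inE orbC; have [//|zNv /=] := eqVneq z v.
    by rewrite (touches_inj_but_end free sP ws zs wz zNv us wu uNv).
  have [/cut_art[x /sep/and3P[]] | /vertex_cutPn conA] :=
      boolP (vertex_cut e [set u; v]).
    rewrite !inE => uNx vNx /negP[].
    (* Without [x], the vertices [u] and [v] stay connected: through the detour if [x] is on [s],
       along [s] itself otherwise. *)
    have [xs | xNs] := boolP (x \in s).
      have [q [_ uqv _ qs _]] := detour ws wu wv.
      apply: (sorted_connect_del (s := u :: rcons q v)) => //.
      + move=> z; rewrite !inE mem_rcons inE => /or3P[/eqP->|/eqP->|/qs] //.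
        by apply: contraNneq => ->.
      + exact: mem_head.
      + by rewrite inE mem_rcons mem_head orbT.
    apply: sorted_connect_del s_sorted _ _ _ us vs => z zs.
    by rewrite inE; apply: contraNneq xNs => <-.
  (* The second vertex [c] of [s] is touched like [u], which is impossible: either [c] is in
     [[set u; v]], or the absence of a cut connects it to [w], against [reach]. *)
  case: s s_sorted s_uniq su sv us vs ws wu wv sP only_uv reach neq_w
    {wNs a a_s wa b_s wb bNa} => [|x [|c r]] //=.
    by move=> _ _ -> /esym/eqP; rewrite eq_sym (negPf uNv).
  move=> _ _ -> _ us vs ws wu wv sP only_uv reach neq_w.
  have cs : c \in [:: u, c & r] by rewrite !inE eqxx orbT.
  have wc : touches [:: u, c & r] w c.
    have [|cA] := boolP (c \in [set u; v]).
      by rewrite !inE => /orP[] /eqP def_c; rewrite {2}def_c.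
    have wA : w \notin [set u; v] by rewrite !inE negb_or !neq_w.
    by have := reach _ c only_uv (conA w c wA cA); rewrite cs.
  exact: (@longest_not_consecutive u v w u c [::] r).
- have only_a1 : {in s, forall z, touches s w z -> z \in [set a]}.
    move=> z zs wz; rewrite inE; apply: contraFT (only_a z) => zNa.
    by rewrite zs wz.
  have wNa : w \notin [set a] by rewrite inE neq_w.
  (* Otherwise [reach] leaves no vertex on [s] except [a], against [u != v]. *)
  have art_a : articulation_point e a.
    apply: contraT => /vertex_cutPn conA.
    have s_sub_a z : z \in s -> z = a.
      move=> zs; apply/eqP; apply: contraTT zs; rewrite -in_set1 => zNa.
      exact: reach only_a1 (conA w z wNa zNa).
    by rewrite (s_sub_a u us) (s_sub_a v vs) eqxx in uNv.
  have aNu : u != a by apply: contraTneq art_a => <-.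
  have aNv : v != a by apply: contraTneq art_a => <-.
  have /and3P[uA vA /negP[]] := sep a art_a.
  have wNadj z : z \in s -> z != a -> ~~ e w z.
    move=> zs zNa; apply/negP=> /(@neighbour_touches s) wz.
    by have := only_a1 z zs wz; rewrite inE (negPf zNa).
  (* Neither [u] nor [v] is adjacent to [w], so they are adjacent to each other, although [a]
     separates them. *)
  have := free_3K1_adj free (neq_w u us) (neq_w v vs) uNv.
  rewrite (negPf (wNadj u us aNu)) (negPf (wNadj v vs aNv)) /= => uv.
  by apply: connect1; rewrite /del_rel /= uA vA.
Qed.

End Graph.

Theorem theorem1 (T : finType) (e : rel T) (u v : T)
    (He : simple_graph e) (Hconn : connected_graph e) (Hfree : free_3K1 e)
    (Huv : u != v) :
  (hamiltonian_path e u v <->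
     [/\ ~~ articulation_point e u /\ ~~ articulation_point e v,
         forall x : T, articulation_point e x -> diff_components e [set x] u v
       & ~~ minimum_vertex_cut e [set u; v]])
  /\
  (hamiltonian_path e u v <->
     [/\ ~~ articulation_point e u /\ ~~ articulation_point e v,
         forall x : T, articulation_point e x -> diff_components e [set x] u v
       & ~~ (vertex_cut e [set u; v] && (#|[set u; v]| == 2))]).
Proof.
have [e_sym _] := He.
have uv_card : #|[set u; v]| = 2 by rewrite cards2 Huv.
have necessary : hamiltonian_path e u v ->
    [/\ ~~ articulation_point e u /\ ~~ articulation_point e v,
        forall x : T, articulation_point e x -> diff_components e [set x] u v
      & ~~ vertex_cut e [set u; v]].
  move=> uv; split; last exact: hamiltonian_not_cut2.
    by split; [apply: hamiltonian_not_articulation uv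
              |apply: hamiltonian_not_articulation (hamiltonian_path_sym _ uv)].
  by move=> x; apply: hamiltonian_separated.
split; split.
- by case/necessary=> art sep /negPf cut; rewrite /minimum_vertex_cut cut.
- case=> [[uNart vNart] sep min_cut].
  apply: hamiltonian_path_of_articulation => // cut.
  exact: cut_connectivity2 min_cut.
- by case/necessary=> art sep /negPf->.
- rewrite uv_card andbT => -[[uNart vNart] sep /negPf cut].
  by apply: hamiltonian_path_of_articulation; rewrite ?cut.
Qed.
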